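(* Work in $\mathrm{IKP}$. For any set $x$, if (1) every $\beta \in x$ satisfies $\beta \in \mathrm{PlOrd}$, and (2) for every $\gamma \in \mathrm{PlOrd}$, if $\gamma \subseteq \beta$ for some $\beta \in x$ then $\gamma \in x$, then $x \in \mathrm{PlOrd}$.
   Context: $\mathrm{IKP}$ is intuitionistic Kripke–Platek set theory (with strong infinity). An ordinal is a transitive set of transitive sets. For sets $\alpha,\gamma$, write $\mathrm{relpl}_\alpha(\gamma)$ for the formula $\forall \delta \in \gamma\ \forall \varepsilon \in \alpha\,(\varepsilon \subseteq \delta \rightarrow \varepsilon \in \gamma)$. $\mathrm{PlOrd}$ is the class of ordinals $\alpha$ such that for all $\beta \in \alpha$ and all $\gamma \subseteq \beta$ with $\mathrm{relpl}_\alpha(\gamma)$, we have $\gamma \in \alpha$ and $\forall \delta \in \alpha\,(\beta \in \delta \rightarrow \gamma \in \delta)$. Elements of $\mathrm{PlOrd}$ are called plump ordinals. *)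

(* Defs.v *)
(* IKP is rendered semantically: a structure (M, mem) whose membership relation
   is Prop-valued (Rocq's logic is intuitionistic), satisfying the axioms of
   intuitionistic Kripke-Platek set theory with strong infinity.  Axiom schemas
   are stated for a deep embedding of first-order formulas of the language {∈,=}
   (bounded = Δ0 formulas for separation/collection, arbitrary formulas for set
   induction). *)

(* Formulas with de Bruijn variables. *)
Inductive form : Type :=
| f_mem : nat -> nat -> form
| f_eq  : nat -> nat -> form
| f_bot : form
| f_and : form -> form -> form
| f_or  : form -> form -> form
| f_imp : form -> form -> form
| f_all : form -> form
| f_ex  : form -> form
| f_ball : nat -> form -> form          (* ∀ v0 ∈ var i (i read outside the binder), A *)
| f_bex  : nat -> form -> form.

Fixpoint delta0 (A : form) : Prop :=
  match A with
  | f_mem _ _ | f_eq _ _ | f_bot => True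
  | f_and B C | f_or B C | f_imp B C => delta0 B /\ delta0 C
  | f_all _ | f_ex _ => False
  | f_ball _ B | f_bex _ B => delta0 B
  end.

Definition scons {M : Type} (a : M) (e : nat -> M) : nat -> M :=
  fun n => match n with 0 => a | S k => e k end.

Fixpoint eval {M : Type} (mem : M -> M -> Prop) (e : nat -> M) (A : form) : Prop :=
  match A with
  | f_mem i j => mem (e i) (e j)
  | f_eq i j => e i = e j
  | f_bot => False
  | f_and B C => eval mem e B /\ eval mem e C
  | f_or B C => eval mem e B \/ eval mem e C
  | f_imp B C => eval mem e B -> eval mem e C
  | f_all B => forall y, eval mem (scons y e) B
  | f_ex B => exists y, eval mem (scons y e) B
  | f_ball i B => forall y, mem y (e i) -> eval mem (scons y e) B
  | f_bex i B => exists y, mem y (e i) /\ eval mem (scons y e) B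
  end.

Definition is_empty {M : Type} (mem : M -> M -> Prop) (z : M) := forall y, ~ mem y z.
Definition is_succ {M : Type} (mem : M -> M -> Prop) (x s : M) :=
  forall y, mem y s <-> (mem y x \/ y = x).
Definition inductive {M : Type} (mem : M -> M -> Prop) (a : M) :=
  (exists z, is_empty mem z /\ mem z a) /\
  (forall x, mem x a -> exists s, is_succ mem x s /\ mem s a).

Record IKPModel : Type := {
  carrier :> Type;
  mem : carrier -> carrier -> Prop;
  ax_ext : forall x y, (forall z, mem z x <-> mem z y) -> x = y;
  ax_pair : forall a b, exists c, mem a c /\ mem b c;
  ax_union : forall a, exists u, forall x, mem x a -> forall y, mem y x -> mem y u;
  ax_strong_inf : exists w, inductive mem w /\
      (forall b, inductive mem b -> forall x, mem x w -> mem x b);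
  ax_d0_sep : forall (A : form), delta0 A -> forall (e : nat -> carrier) (a : carrier),
      exists b, forall x, mem x b <-> (mem x a /\ eval mem (scons x e) A);
  ax_d0_coll : forall (A : form), delta0 A -> forall (e : nat -> carrier) (a : carrier),
      (forall x, mem x a -> exists y, eval mem (scons y (scons x e)) A) ->
      exists b, forall x, mem x a -> exists y, mem y b /\ eval mem (scons y (scons x e)) A;
  ax_set_ind : forall (A : form) (e : nat -> carrier),
      (forall a, (forall x, mem x a -> eval mem (scons x e) A) -> eval mem (scons a e) A) ->
      forall a, eval mem (scons a e) A
}.

Arguments mem {_}.

Section Notions.
Variable M : IKPModel.

Definition subset (a b : M) := forall z, mem z a -> mem z b.
Definition transitive (a : M) := forall y, mem y a -> subset y a.
Definition ordinal (a : M) := transitive a /\ forall y, mem y a -> transitive y.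

Definition relpl (alpha gamma : M) :=
  forall delta, mem delta gamma -> forall eps, mem eps alpha -> subset eps delta -> mem eps gamma.

Definition PlOrd (alpha : M) :=
  ordinal alpha /\
  forall beta, mem beta alpha -> forall gamma, subset gamma beta -> relpl alpha gamma ->
    mem gamma alpha /\ (forall delta, mem delta alpha -> mem beta delta -> mem gamma delta).
End Notions.

Arguments subset {M}. Arguments transitive {M}. Arguments ordinal {M}.
Arguments relpl {M}. Arguments PlOrd {M}.

(* Main.v *)
Require Import Defs.

(* Every element of a plump ordinal α is relatively plump in α (by ∈-induction),
   and a relatively plump subset of a plump ordinal is plump; hence elements of
   plump ordinals are plump.  So x is transitive by (2).  Given γ ⊆ β ∈ x with
   relpl_x(γ), γ is a relatively plump subset of β, hence plump and in x by (2);
   and γ ∈ δ whenever β ∈ δ ∈ x, by plumpness of δ since δ ⊆ x. *)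

Section PlumpOrdinals.
Variable M : IKPModel.

Lemma relpl_sub (a b g : M) : subset b a -> relpl a g -> relpl b g.
Proof.
  intros Hba Hg d Hd e He. apply Hg; [exact Hd | exact (Hba e He)].
Qed.

Lemma relpl_trans (a b g : M) : relpl a b -> subset g b -> relpl b g -> relpl a g.
Proof.
  intros Hb Hgb Hg d Hd e He Hed.
  apply (Hg d Hd e); [apply (Hb d (Hgb d Hd) e He Hed) | exact Hed].
Qed.

Lemma PlOrd_transitive (a : M) : PlOrd a -> transitive a.
Proof. intros [[Ta _] _]. exact Ta. Qed.

Lemma PlOrd_relpl_sub (b g : M) : PlOrd b -> subset g b -> relpl b g -> PlOrd g.
Proof.
  intros [[Tb Tbel] Pb] Hgb Hg.
  assert (Tg : transitive g).
  { intros d Hd z Hz.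
    assert (Hdb : mem d b) by exact (Hgb d Hd).
    apply (Hg d Hd z); [exact (Tb d Hdb z Hz) | exact (Tbel d Hdb z Hz)]. }
  split; [split; [exact Tg | intros y Hy; exact (Tbel y (Hgb y Hy))] |].
  intros b' Hb' g' Hg'b' Hg'.
  assert (Hrel : relpl b g').
  { apply (relpl_trans b g g'); [exact Hg | exact (fun z Hz => Tg b' Hb' z (Hg'b' z Hz)) | exact Hg']. }
  destruct (Pb b' (Hgb b' Hb') g' Hg'b' Hrel) as [Hg'b Hg'in].
  split.
  - exact (Hg b' Hb' g' Hg'b Hg'b').
  - intros d Hd. exact (Hg'in d (Hgb d Hd)).
Qed.

Lemma PlOrd_mem_relpl (a eps : M) : PlOrd a -> mem eps a -> relpl a eps.
Proof.
  intros Pa.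
  (* ∀ε∈a (d ∈ ε → ∀e∈a (e ⊆ d → e ∈ ε)), proved for all d by ∈-induction *)
  pose (A := f_ball 1 (f_imp (f_mem 1 0)
               (f_ball 2 (f_imp (f_ball 0 (f_mem 0 3)) (f_mem 0 1))))).
  assert (Hind := ax_set_ind M A (fun _ => a)). simpl in Hind.
  intros Heps d Hd. revert eps Heps Hd. apply Hind. clear d Hind.
  intros d IH eps Heps Hd e He Hed.
  destruct Pa as [[Ta _] Pa].
  assert (Hrel : relpl a e).
  { intros d' Hd' e' He' He'd'. exact (IH d' (Hed d' Hd') e He Hd' e' He' He'd'). }
  exact (proj2 (Pa d (Ta eps Heps d Hd) e Hed Hrel) eps Heps Hd).
Qed.

Lemma PlOrd_mem (a b : M) : PlOrd a -> mem b a -> PlOrd b.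
Proof.
  intros Pa Hb.
  exact (PlOrd_relpl_sub a b Pa (PlOrd_transitive a Pa b Hb) (PlOrd_mem_relpl a b Pa Hb)).
Qed.

End PlumpOrdinals.

Theorem proposition2p6 (M : IKPModel) (x : M) :
  (forall beta, mem beta x -> PlOrd beta) ->
  (forall gamma, PlOrd gamma -> (exists beta, mem beta x /\ subset gamma beta) -> mem gamma x) ->
  PlOrd x.
Proof.
  intros Hx Hclosed.
  assert (Tx : transitive x).
  { intros b Hb y Hy. apply Hclosed.
    - exact (PlOrd_mem M b y (Hx b Hb) Hy).
    - exists b. split; [exact Hb | exact (PlOrd_transitive M b (Hx b Hb) y Hy)]. }
  split; [split; [exact Tx | intros y Hy; exact (PlOrd_transitive M y (Hx y Hy))] |].
  intros b Hb g Hgb Hg.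
  split.
  - apply Hclosed.
    + exact (PlOrd_relpl_sub M b g (Hx b Hb) Hgb (relpl_sub M x b g (Tx b Hb) Hg)).
    + exists b. split; assumption.
  - intros d Hd Hbd.
    destruct (Hx d Hd) as [_ Pd].
    exact (proj1 (Pd b Hbd g Hgb (relpl_sub M x d g (Tx d Hd) Hg))).
Qed.
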